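(* Let $G$ be a block-rigid $CRQ$-group of ring type. Then $G$ is an $afi$-group, i.e. every absolute ideal of $G$ is a fully invariant subgroup of $G$.
   Context: All groups are abelian and written additively. A multiplication on a group $G$ is a homomorphism $\mu:G\otimes G\to G$, written $g_1\times g_2=\mu(g_1\otimes g_2)$; $G$ with a multiplication is called a ring on $G$ (no associativity, commutativity or unit is required). A subgroup of $G$ is an absolute ideal of $G$ if it is a (two-sided) ideal in every ring on $G$. A group $G$ is an $afi$-group if every absolute ideal of $G$ is a fully invariant subgroup of $G$ (invariant under all endomorphisms of $G$). A torsion-free group $G$ of finite rank is almost completely decomposable (an $ACD$-group) if it contains a completely decomposable subgroup of finite index. Its regulator $\mathrm{Reg}\,G$ is the intersection of all regulating subgroups (completely decomposable subgroups of least possible index in $G$); it is a completely decomposable fully invariant subgroup of finite index. A $CRQ$-group is an $ACD$-group $G$ for which the regulator quotient $G/\mathrm{Reg}\,G$ is cyclic. Write $\mathrm{Reg}\,G$ as a direct sum of rank-one groups; for a type $\tau$, $\mathrm{Reg}_\tau G$ is the sum of the rank-one summands of type $\tau$, and $T(G)=\{\tau\mid\mathrm{Reg}_\tau G\neq 0\}$ is the set of critical types of $G$. $G$ is block-rigid if the types in $T(G)$ are pairwise incomparable. $G$ is of ring type if all types in $T(G)$ are idempotent, i.e. each is represented by a characteristic with all entries in $\{0,\infty\}$. *)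

(* Defs.v *)
From HB Require Import structures.
From mathcomp Require Export all_boot all_order all_algebra.
From mathcomp Require Export boolp classical_sets functions cardinality.

Set Implicit Arguments.
Unset Strict Implicit.
Unset Printing Implicit Defensive.

Import GRing.Theory.

Local Open Scope classical_set_scope.
Local Open Scope ring_scope.

(* Abelian groups are [zmodType]s; subgroups of G are sets [H : set G].
   Notions such as rank, height and type are defined for a subgroup of an
   ambient torsion-free group G; G itself is the subgroup [setT]. *)

Section Subgroups.
Variable G : zmodType.
Implicit Types H I : set G.

Definition subgroup H : Prop := zmod_closed (mem H).

Definition cosets H : set (set G) := range (fun x => [set y | H (y - x)]).

Definition has_index H (m : nat) : Prop := (cosets H #= `I_m)%card.

Definition cyclic_quotient H : Prop :=
  exists g : G, forall x, exists k : int, H (x - g *~ k).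

Definition fully_invariant I : Prop :=
  subgroup I /\ forall f : {additive G -> G}, f @` I `<=` I.

(* A homomorphism mu from the tensor square of G to G is given as a
   biadditive map. *)
Definition multiplication (mu : G -> G -> G) : Prop :=
  (forall x, zmod_morphism (mu x)) /\ (forall y, zmod_morphism (mu^~ y)).

Definition ideal (mu : G -> G -> G) I : Prop :=
  subgroup I /\ forall g x, I x -> I (mu g x) /\ I (mu x g).

Definition absolute_ideal I : Prop :=
  forall mu, multiplication mu -> ideal mu I.

End Subgroups.

Definition afi_group (G : zmodType) : Prop :=
  forall I : set G, absolute_ideal I -> fully_invariant I.

Definition torsion_free (G : zmodType) : Prop :=
  forall (x : G) (n : nat), x *+ n = 0 -> x = 0 \/ n = 0%N.

Definition independent (G : zmodType) (n : nat) (x : 'I_n -> G) : Prop :=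
  forall c : 'I_n -> int, \sum_i x i *~ c i = 0 -> forall i, c i = 0.

Definition has_rank (G : zmodType) (A : set G) (n : nat) : Prop :=
  (exists2 x : 'I_n -> G, (forall i, A (x i)) & independent x) /\
  (forall x : 'I_n.+1 -> G, (forall i, A (x i)) -> ~ independent x).

Definition finite_rank (G : zmodType) : Prop := exists n, has_rank [set: G] n.

(* Characteristics and types; [None] stands for infinity. *)

Definition characteristic := {p : nat | prime p} -> option nat.

Definition height_le (a b : option nat) : Prop :=
  match a, b with
  | _, None => True
  | None, Some _ => False
  | Some m, Some n => (m <= n)%N
  end.

Definition char_equiv (chi psi : characteristic) : Prop :=
  finite_set [set p | chi p <> psi p] /\
  forall p, chi p <> psi p -> chi p <> None /\ psi p <> None.

(* A type is a [char_equiv]-class, represented as a set of characteristics. *)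
Definition gtype := set characteristic.

Definition gtype_le (tau sigma : gtype) : Prop :=
  exists chi psi, [/\ tau chi, sigma psi & forall p, height_le (chi p) (psi p)].

Definition idempotent_type (tau : gtype) : Prop :=
  exists2 chi, tau chi & forall p, chi p = Some 0%N \/ chi p = None.

Section Types.
Variable G : zmodType.
Implicit Types A H : set G.

Definition divides_in A (n : nat) (x : G) : Prop := exists2 y, A y & x = y *+ n.

(* The p-height of x in A: the least k such that p^(k+1) does not divide x
   in A, or infinity if there is no such k. *)
Definition height A (x : G) : characteristic := fun p =>
  match pselect (exists k, `[< ~ divides_in A (val p ^ k.+1) x >]) with
  | left ex => Some (ex_minn ex)
  | right _ => None
  end.

Definition rank_one A : Prop := subgroup A /\ has_rank A 1.

(* Meaningful for A of rank one, where all nonzero elements of A have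
   equivalent characteristics. *)
Definition type_of A : gtype :=
  [set chi | exists x, [/\ A x, x <> 0 & char_equiv (height A x) chi]].

Definition direct_sum H (n : nat) (A : 'I_n -> set G) : Prop :=
  [/\ forall i, subgroup (A i),
      H = [set x | exists2 a : 'I_n -> G, (forall i, A i (a i)) & x = \sum_i a i]
    & forall a : 'I_n -> G,
        (forall i, A i (a i)) -> \sum_i a i = 0 -> forall i, a i = 0].

Definition cd_decomposition H (n : nat) (A : 'I_n -> set G) : Prop :=
  direct_sum H A /\ forall i, rank_one (A i).

Definition completely_decomposable H : Prop :=
  exists n (A : 'I_n -> set G), cd_decomposition H A.

Definition type_component (n : nat) (A : 'I_n -> set G) (tau : gtype) : set G :=
  [set x | exists2 a : 'I_n -> G, (forall i, A i (a i)) &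
           x = \sum_(i < n | `[< type_of (A i) = tau >]) a i].

End Types.

Definition acd_group (G : zmodType) : Prop :=
  [/\ torsion_free G, finite_rank G &
      exists (C : set G) m, completely_decomposable C /\ has_index C m].

Definition regulating (G : zmodType) (C : set G) : Prop :=
  completely_decomposable C /\
  exists2 m, has_index C m &
    forall (C' : set G) m',
      completely_decomposable C' -> has_index C' m' -> (m <= m')%N.

Definition Reg (G : zmodType) : set G :=
  \bigcap_(C in [set C : set G | regulating C]) C.
Arguments Reg G : clear implicits.

Definition crq_group (G : zmodType) : Prop :=
  acd_group G /\ cyclic_quotient (Reg G).

(* Whether the component of type tau vanishes does not depend on the chosen
   decomposition of the regulator. *)
Definition critical_types (G : zmodType) : set gtype :=
  [set tau | exists n (A : 'I_n -> set G),
     cd_decomposition (Reg G) A /\ type_component A tau <> [set 0]].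

Definition block_rigid (G : zmodType) : Prop :=
  forall tau sigma, critical_types G tau -> critical_types G sigma ->
    tau <> sigma -> ~ gtype_le tau sigma /\ ~ gtype_le sigma tau.

Definition ring_type (G : zmodType) : Prop :=
  forall tau, critical_types G tau -> idempotent_type tau.

(* Main.v *)
From HB Require Import structures.
Require Import Defs.
From mathcomp Require Import zify ring.

Set Implicit Arguments.
Unset Strict Implicit.
Unset Printing Implicit Defensive.

Import GRing.Theory Num.Theory.

Local Open Scope classical_set_scope.
Local Open Scope ring_scope.

(** Write R for the regulator.  Two regulating subgroups contain R and have the
same index, and a cyclic group has at most one subgroup of a given index; so
R is itself the only regulating subgroup ([crq_Reg_regulating]).  In particular
R is completely decomposable, and no completely decomposable subgroup of G
properly contains it ([crq_Reg_max]).

A rank-one group of idempotent type is [Z_S e], where [S] is a set of primes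
and [Z_S] is the ring of integers localized by inverting [S]
([generator_line]).  Hence G embeds in a space of rational vectors so that R
becomes the product of the rings [Z_(S i)] ([coordinates_exist]), and
block-rigidity says that an inclusion between two of the sets [S i] is an
equality.

The heart of the matter is that an endomorphism f of G maps R into R.  The image
under f of the i-th summand of R is divisible by all powers of the primes of
[S i], so it only has coordinates j with [S j = S i].  An element of G whose
coordinates all belong to one such class lies in R ([coord_pure]); otherwise,
replacing one basis vector by a suitable combination of that element with it
would give a completely decomposable subgroup properly containing R
([coord_adjoin]).

Let g generate G modulo R.  Then f(g) is congruent modulo R to some multiple k g,
and since f preserves R, the map h(x) = f(x) - k x sends G into R.  An ideal
that contains x contains k x, so only h(x) matters.  Because the i-th coordinates
of G form the group generated by [Z_(S i)] and one rational number, some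
integer multiple lambda of the i-th coordinate has values in [Z_(S i)] and takes
the value 1 ([localization_span1]).  The product of x and y defined as lambda(y)
times the i-th component of h(x) is a multiplication on G, since R is a module
over the product of the [Z_(S i)].  Choosing y with lambda(y) = 1 puts the i-th
component of h(x) into every absolute ideal containing x; the sum over i is
h(x) ([absolute_ideal_hom]). *)

(** * Subgroups and cyclic quotients *)

Section SubgroupTheory.
Variable G : zmodType.
Implicit Types (H C I : set G) (x y g : G).

Lemma subgroupP H :
  subgroup H <-> H 0 /\ (forall x y, H x -> H y -> H (x - y)).
Proof.
split=> [[H0 HB]|[H0 HB]]; split.
- by move: H0; rewrite in_setE.
- by move=> x y Hx Hy; have := HB x y; rewrite !in_setE; apply.
- by rewrite in_setE.
- by move=> x y; rewrite !in_setE; apply: HB.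
Qed.

Lemma subgroup0 H : subgroup H -> H 0.
Proof. by case/subgroupP. Qed.

Lemma subgroupB H x y : subgroup H -> H x -> H y -> H (x - y).
Proof. by case/subgroupP=> _; apply. Qed.

Lemma subgroupN H x : subgroup H -> H x -> H (- x).
Proof. by move=> sH Hx; rewrite -sub0r; apply: subgroupB (subgroup0 sH) _. Qed.

Lemma subgroupD H x y : subgroup H -> H x -> H y -> H (x + y).
Proof. by move=> sH Hx Hy; rewrite -(opprK y); apply: subgroupB => //; apply: subgroupN. Qed.

Lemma subgroupMn H x n : subgroup H -> H x -> H (x *+ n).
Proof.
move=> sH Hx; elim: n => [|n IHn]; first exact: subgroup0.
by rewrite mulrS; apply: subgroupD.
Qed.

Lemma subgroupMz H x k : subgroup H -> H x -> H (x *~ k).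
Proof.
move=> sH Hx; case: k => n; first exact: subgroupMn.
by apply: subgroupN => //; apply: subgroupMn.
Qed.

Lemma subgroup_sum H (I : Type) (r : seq I) (P : pred I) (F : I -> G) :
  subgroup H -> (forall i, P i -> H (F i)) -> H (\sum_(i <- r | P i) F i).
Proof.
move=> sH HF; elim/big_ind: _ => //; first exact: subgroup0.
by move=> x y Hx Hy; apply: subgroupD.
Qed.

Lemma subgroup_coset H x y : subgroup H ->
  [set z | H (z - x)] = [set z | H (z - y)] <-> H (x - y).
Proof.
move=> sH; split=> [/seteqP[/(_ x) + _]|Hxy].
  by rewrite /= subrr; apply; apply: subgroup0.
apply/seteqP; split=> z /= Hz.
  by have := subgroupD sH Hz Hxy; rewrite addrA subrK.
by have := subgroupB sH Hz Hxy; rewrite opprB addrA subrK.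
Qed.

Lemma absolute_ideal_subgroup I : absolute_ideal I -> subgroup I.
Proof.
have mul0 : multiplication (fun _ _ : G => 0) by split=> z x y; rewrite subr0.
by move=> /(_ _ mul0)[].
Qed.

Lemma index_unique H m m' : has_index H m -> has_index H m' -> m = m'.
Proof.
by move=> h h'; apply/card_eq_II/(card_eq_trans _ h'); rewrite card_eq_sym.
Qed.

(** Two of the multiples of [x] share a coset, by the pigeonhole principle. *)
Lemma index_multiple H m x : subgroup H -> has_index H m ->
  exists2 k, (0 < k)%N & H (x *+ k).
Proof.
move=> sH hm; apply: contrapT => noK.
have : finite_set [set [set y | H (y - x *+ k)] | k in [set: nat]].
  apply: (@sub_finite_set _ _ (cosets H)); last by apply/finite_setP; exists m.
  by move=> _ [k _ <-]; exists (x *+ k).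
have : ([set [set y | H (y - x *+ k)] | k in [set: nat]] #= [set: nat])%card.
  apply: inj_card_eq => j k _ _ /(subgroup_coset _ _ sH) Hjk.
  case: (ltngtP j k) => // lt; case: noK.
    exists (k - j)%N; first by rewrite subn_gt0.
    by rewrite mulrnBr 1?ltnW // -opprB; apply: subgroupN.
  exists (j - k)%N; first by rewrite subn_gt0.
  by rewrite mulrnBr 1?ltnW.
by move=> /eq_finite_set -> /infinite_nat.
Qed.

(** The least positive [d] with [g *+ d] in [C] is the order of [g] modulo [C],
and the multiples of [g] by the integers below [d] represent the cosets. *)
Lemma cyclic_index C g k : subgroup C -> (forall x, exists j : int, C (x - g *~ j)) ->
  (0 < k)%N -> C (g *+ k) ->
  exists d, [/\ (0 < d)%N, has_index C d & forall j : int, C (g *~ j) <-> (d%:Z %| j)%Z].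
Proof.
move=> sC genC k0 Ck.
have exd : exists d, (0 < d)%N && `[< C (g *+ d) >].
  by exists k; rewrite k0; apply/asboolP.
case: (ex_minnP exd) => d /andP[d0 /asboolP Cd] mind.
have CP (j : int) : C (g *~ j) <-> (d%:Z %| j)%Z.
  split=> [Cj|/dvdzP[q ->]]; last by rewrite mulrC mulrzA; apply: subgroupMz.
  have Cr : C (g *~ (j %% d)%Z).
    rewrite /modz mulrzBr mulrC mulrzA; apply: subgroupB => //.
    exact: subgroupMz.
  have r0 : (0 <= (j %% d)%Z) by apply: modz_ge0; lia.
  have rd : ((j %% d)%Z < d%:Z) by apply: ltz_pmod; lia.
  case e : (j %% d)%Z r0 rd Cr => [[|r]|] // _ rd Cr; first exact/dvdz_mod0P.
  by have := mind r.+1; rewrite /= asboolT // => /(_ isT); lia.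
exists d; split=> //; rewrite /has_index.
have -> : cosets C = [set [set y | C (y - g *+ j)] | j in `I_d].
  apply/seteqP; split=> _ [x _ <-]; last by exists (g *+ x).
  have [j Cj] := genC x; exists (`|(j %% d)%Z|%N).
    rewrite /=; have := @ltz_pmod j d; have := @modz_ge0 j d; lia.
  apply/subgroup_coset => //.
  have -> : g *+ `|(j %% d)%Z|%N = g *~ (j %% d)%Z.
    rewrite pmulrn; congr (_ *~ _); have := @modz_ge0 j d; lia.
  have -> : g *~ (j %% d)%Z - x = - (x - g *~ j) - g *~ (j - (j %% d)%Z).
    by rewrite mulrzBr !opprB [RHS]addrC addrA subrK.
  by apply: subgroupB => //; [apply: subgroupN | apply/CP; rewrite -eqz_mod_dvd modz_mod].
apply: card_eq_trans (inj_card_eq _) _; last exact: card_eqxx.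
move=> j k'; rewrite !in_setE /= => jd k'd /subgroup_coset-/(_ sC).
rewrite !pmulrn -mulrzBr => /CP; rewrite -eqz_mod_dvd.
rewrite !modz_small; lia.
Qed.

(** A subgroup containing [H] is determined by the multiples of the generator
that it contains, hence by its index. *)
Lemma cyclic_index_eq H C C' m : cyclic_quotient H ->
  subgroup C -> subgroup C' -> H `<=` C -> H `<=` C' ->
  has_index C m -> has_index C' m -> C = C'.
Proof.
move=> [g genH] sC sC' HC HC' im im'.
have ind D : subgroup D -> H `<=` D -> has_index D m ->
    forall j : int, D (g *~ j) <-> (m%:Z %| j)%Z.
  move=> sD HD iD; have [k k0 Dk] := index_multiple g sD iD.
  have genD x : exists j : int, D (x - g *~ j).
    by have [j Hj] := genH x; exists j; apply: HD.
  have [d [d0 id Dd]] := cyclic_index sD genD k0 Dk.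
  by rewrite (index_unique iD id).
have sub D D' : subgroup D -> subgroup D' -> H `<=` D -> H `<=` D' ->
    has_index D m -> has_index D' m -> D `<=` D'.
  move=> sD sD' HD HD' iD iD' x Dx; have [j Hj] := genH x.
  have : D (g *~ j).
    by rewrite -(subKr x (g *~ j)); apply: subgroupB => //; apply: HD.
  move=> /(ind D sD HD iD)/(ind D' sD' HD' iD') D'j.
  by rewrite -(subrK (g *~ j) x); apply: subgroupD => //; apply: HD'.
by apply/seteqP; split; apply: sub.
Qed.

(** The order of the generator modulo the larger subgroup divides its order
modulo the smaller one. *)
Lemma cyclic_index_le H C C' m : cyclic_quotient H ->
  subgroup C -> subgroup C' -> H `<=` C -> C `<=` C' -> has_index C m ->
  exists2 m', has_index C' m' & (m' <= m)%N.
Proof.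
move=> [g genH] sC sC' HC CC' im.
have [k k0 Ck] := index_multiple g sC im.
have genC x : exists j : int, C (x - g *~ j).
  by have [j Hj] := genH x; exists j; apply: HC.
have genC' x : exists j : int, C' (x - g *~ j).
  by have [j Hj] := genC x; exists j; apply: CC'.
have [d [d0 id Cd]] := cyclic_index sC genC k0 Ck.
have [d' [d'0 id' C'd']] := cyclic_index sC' genC' k0 (CC' _ Ck).
exists d' => //; rewrite (index_unique im id); apply: dvdn_leq => //.
by have /C'd' := CC' _ (proj2 (Cd d) (dvdzz _)).
Qed.

End SubgroupTheory.

(** * Localizations of the integers *)

Definition prime_supported (S : set nat) (N : nat) : Prop :=
  (0 < N)%N /\ forall p, prime p -> (p %| N)%N -> S p.

Lemma prime_supported1 S : prime_supported S 1.
Proof. by split=> // p pp; rewrite dvdn1 => /eqP p1; rewrite p1 in pp. Qed.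

Lemma prime_supportedM S M N :
  prime_supported S M -> prime_supported S N -> prime_supported S (M * N).
Proof.
move=> [M0 SM] [N0 SN]; split=> [|p pp]; first by rewrite muln_gt0 M0.
by rewrite Euclid_dvdM // => /orP[/SM|/SN]; apply.
Qed.

Lemma prime_supported_prime (S : set nat) p : prime p -> S p -> prime_supported S p.
Proof.
move=> pp Sp; split=> [|q pq]; first exact: prime_gt0.
by rewrite dvdn_prime2 // => /eqP ->.
Qed.

Lemma prime_supported_coprime S p N : prime p -> ~ S p -> prime_supported S N ->
  coprime p N.
Proof. by move=> pp nSp [_ SN]; rewrite prime_coprime //; apply/negP => pN; apply/nSp/SN. Qed.

(** The elements [(c / N) e] of [G], with [N] a product of primes of [S]. *)
Definition line (G : zmodType) (S : set nat) (e : G) : set G :=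
  [set z | exists2 N, prime_supported S N & exists c : int, z *+ N = e *~ c].

Lemma line_subgroup (G : zmodType) S (e : G) : subgroup (line S e).
Proof.
apply/subgroupP; split.
  by exists 1%N; [exact: prime_supported1 | exists 0; rewrite mul0rn].
move=> x y [N SN [c xN]] [M SM [b yM]].
exists (N * M)%N; first exact: prime_supportedM.
exists (c * M%:Z - b * N%:Z); rewrite mulrnBl mulrnA xN mulnC mulrnA yM.
by rewrite mulrzBr !mulrzA !pmulrn.
Qed.

(** Inside the rationals the line of 1 is the subring generated by the inverses
of the primes of [S]. *)
Definition localization (S : set nat) : set rat := line S 1.

Lemma localizationP S (q : rat) : localization S q <->
  exists2 N, prime_supported S N & exists c : int, q = c%:~R / N%:R.
Proof.
have nz N : prime_supported S N -> (N%:R : rat) != 0.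
  by case; rewrite pnatr_eq0 lt0n.
split=> -[N SN [c e]]; exists N => //; exists c.
  by apply: (canRL (mulfK (nz _ SN))); rewrite mulr_natr.
by rewrite e -[LHS]mulr_natr mulfVK // nz.
Qed.

Lemma localization_int S (c : int) : localization S c%:~R.
Proof. by exists 1%N; [exact: prime_supported1 | exists c]. Qed.

Lemma localizationM S q r :
  localization S q -> localization S r -> localization S (q * r).
Proof.
move=> /localizationP[N SN [c ->]] /localizationP[M SM [b ->]].
apply/localizationP; exists (N * M)%N; first exact: prime_supportedM.
by exists (c * b); rewrite natrM intrM invfM mulrACA.
Qed.

Lemma localization_inv S N : prime_supported S N -> localization S N%:R^-1.
Proof. by move=> SN; apply/localizationP; exists N => //; exists 1; rewrite mul1r. Qed.

Lemma localization_div S q N :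
  prime_supported S N -> localization S q -> localization S (q / N%:R).
Proof. by move=> SN Sq; apply: localizationM => //; apply: localization_inv. Qed.

Lemma localizationB S q r :
  localization S q -> localization S r -> localization S (q - r).
Proof. exact: subgroupB (line_subgroup S 1). Qed.

Lemma localizationD S q r :
  localization S q -> localization S r -> localization S (q + r).
Proof. exact: subgroupD (line_subgroup S 1). Qed.

(** A numerator divisible by every power of a prime vanishes. *)
Lemma localization_divisible S p q : prime p ->
  (forall k, exists2 u, localization S u & q = u *+ p ^ k) -> q != 0 -> S p.
Proof.
move=> pp divq q0; apply: contrapT => nSp; move: q0.
have [u Su] := divq 0%N; rewrite expn0 mulr1n => eu; rewrite -eu in Su.
have [N SN [a qE]] := (localizationP _ _).1 Su.
have N0 : (N%:R : rat) != 0 by case: SN; rewrite pnatr_eq0 lt0n.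
have [w /localizationP[M SM [b ->]]] := divq `|a|%N.
have M0 : (M%:R : rat) != 0 by case: SM; rewrite pnatr_eq0 lt0n.
rewrite qE -[RHS]mulr_natr => /(congr1 ( *%R^~ N%:R)) /=; rewrite divfK // => aE.
have /eqP : (a * M)%:~R = (b * (p ^ `|a|)%N * N)%:~R :> rat.
  by rewrite !intrM aE; field.
rewrite eqr_int => /eqP abM.
have : (p ^ `|a| %| `|a| * M)%N.
  by rewrite -(abszM a M) abM !abszM mulnAC dvdn_mull.
rewrite Gauss_dvdl; last exact/coprimeXl/(prime_supported_coprime pp nSp).
case: (posnP `|a|%N) => [/eqP|a0 /(dvdn_leq a0)].
  by rewrite absz_eq0 => /eqP ->; rewrite mul0r eqxx.
by rewrite leqNgt ltn_expl // prime_gt1.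
Qed.

(** The module generated by [q] over [Z_S], together with [Z_S], is the multiple
of [Z_S] by [1 / d].  Here [d] is minimal with [d * q] in [Z_S]: a prime
dividing both [d] and the numerator of [d * q] could be cancelled from [d], so
the two are coprime and a Bezout relation gives 1. *)
Lemma localization_span1 S (q : rat) : exists d : nat, localization S (d%:R * q) /\
  exists u v : int, d%:R * (u%:~R + v%:~R * q) = 1.
Proof.
have exd : exists d, (0 < d)%N && `[< localization S (d%:R * q) >].
  exists `|denq q|%N; rewrite absz_gt0 denq_neq0; apply/asboolP.
  rewrite -[q in _ * q]divq_num_den mulrC natr_absz normr_denq mulfVK ?intr_eq0 //.
  exact: localization_int.
case: (ex_minnP exd) => d /andP[d0 /asboolP Sdq] mind.
exists d; split=> //.
have [N SN [a dq]] := (localizationP _ _).1 Sdq.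
have N0 : (N%:R : rat) != 0 by case: SN; rewrite pnatr_eq0 lt0n.
have /coprimezP[[u v] /= uv] : coprimez d a.
  rewrite coprimezE /= /coprime eqn_leq gcdn_gt0 d0 andbT leqNgt; apply/negP => g1.
  have pp := pdiv_prime g1; set l := pdiv _ in pp.
  have /dvdnP[d' d'E] : (l %| d)%N := dvdn_trans (pdiv_dvd _) (dvdn_gcdl _ _).
  have /dvdzP[a' a'E] : (l%:Z %| a)%Z.
    by rewrite dvdzE; apply: dvdn_trans (pdiv_dvd _) (dvdn_gcdr _ _).
  have l0 : (l%:R : rat) != 0 by rewrite pnatr_eq0 -lt0n prime_gt0.
  have Sd' : localization S (d'%:R * q).
    apply/localizationP; exists N => //; exists a'; apply: (mulfI l0).
    by rewrite mulrA -natrM mulnC -d'E dq a'E rmorphM /=; field.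
  have := mind d'; rewrite asboolT // andbT => /(_ ltac:(nia)).
  by have := prime_gt1 pp; nia.
exists u, (v * N%:Z).
have uvQ : u%:~R * d%:R + v%:~R * a%:~R = 1 :> rat.
  by rewrite pmulrn -!intrM -intrD uv.
rewrite intrM -[RHS]uvQ.
transitivity (u%:~R * d%:R + v%:~R * (N%:R * (d%:R * q))); first by ring.
by rewrite dq; field.
Qed.

(** The numerator of [y *+ p] is prime to [p], so a Bezout relation turns the
denominator [p] of [y] into the fraction [1 / p]. *)
Lemma localization_prime_denominator S p y : prime p -> ~ S p ->
  localization S (y *+ p) -> ~ localization S y ->
  exists u v : int, y * u%:~R + v%:~R = p%:R^-1.
Proof.
move=> pp nSp /localizationP[N SN [a pyE]] nSy.
have N0 : (N%:R : rat) != 0 by case: SN; rewrite pnatr_eq0 lt0n.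
have p0 : (p%:R : rat) != 0 by rewrite pnatr_eq0 -lt0n prime_gt0.
have /coprimezP[[u v] /= uv] : coprimez p a.
  rewrite coprimezE /= prime_coprime //; apply/negP => pa.
  have /dvdzP[b bE] : (p%:Z %| a)%Z by rewrite dvdzE.
  apply/nSy/localizationP; exists N => //; exists b; apply: (mulIf p0).
  by rewrite mulr_natr pyE bE intrM -pmulrn mulrAC.
exists (v * N%:Z), u; apply: (mulIf p0).
have uvQ : u%:~R * p%:R + v%:~R * a%:~R = 1 :> rat.
  by rewrite pmulrn -!intrM -intrD uv.
rewrite mulVf // -[RHS]uvQ intrM.
transitivity (u%:~R * p%:R + v%:~R * (N%:R * (y *+ p))); last by rewrite pyE; field.
by rewrite -mulr_natr; ring.
Qed.

(** * Rank-one groups of idempotent type *)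

Section RankOne.
Variable G : zmodType.
Hypothesis tfG : torsion_free G.
Implicit Types (A B : set G) (x y e : G).

Lemma torsion_free_mulz x (c : int) : x *~ c = 0 -> x = 0 \/ c = 0.
Proof.
case: c => n; first by case/tfG => ->; [left | right].
by rewrite NegzE mulrNz => /eqP; rewrite oppr_eq0 => /eqP /tfG[]; [left|].
Qed.

Lemma torsion_free_mulIn x y n : (0 < n)%N -> x *+ n = y *+ n -> x = y.
Proof.
move=> n0 /eqP; rewrite -subr_eq0 -mulrnBl => /eqP /tfG[/eqP|n0'].
  by rewrite subr_eq0 => /eqP.
by rewrite n0' in n0.
Qed.

(** Two relations [z *+ N = e *~ c] with the same [e] give a linear relation
between the two elements on the left. *)
Lemma line_rank_one S e : e <> 0 -> rank_one (line S e).
Proof.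
move=> e0; split; first exact: line_subgroup.
have le : line S e e by exists 1%N; [exact: prime_supported1 | exists 1].
split.
  exists (fun=> e) => // c; rewrite big_ord1 => /torsion_free_mulz[//|c0] i.
  by rewrite (ord1 i).
move=> x xl ind; have [N [N0 _] [c xN]] := xl ord0; have [M [M0 _] [b xM]] := xl ord_max.
pose k (a b : int) (i : 'I_2) := if i == ord0 then a else b.
have rel (u v : int) : x ord0 *~ u + x ord_max *~ v = 0 -> u = 0 /\ v = 0.
  move=> uv; have := ind (k u v); rewrite !big_ord_recl big_ord0 addr0 /k /=.
  rewrite (_ : lift ord0 ord0 = ord_max); last exact: val_inj.
  by move=> /(_ uv) h; split; [exact: (h ord0) | exact: (h ord_max)].
have [] := rel (N%:Z * b) (- (M%:Z * c)).
  rewrite mulrzA mulrNz [x ord_max *~ _]mulrzA -!pmulrn xN xM -!mulrzA.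
  by rewrite [b * c]mulrC subrr.
move=> Nb /eqP; rewrite oppr_eq0 => Mc.
have c0 : c = 0 by nia.
have [|NZ _] := rel N%:Z 0; first by rewrite -pmulrn xN c0 !mulr0z addr0.
by lia.
Qed.

(** The coordinate of [z] with respect to [e], for dependent [z] and [e]. *)
Definition ratio e z : rat := xget 0
  [set q | exists N (c : int), [/\ (0 < N)%N, z *+ N = e *~ c & q = c%:~R / N%:R]].

Lemma ratioE e z N (c : int) : e <> 0 -> (0 < N)%N -> z *+ N = e *~ c ->
  ratio e z = c%:~R / N%:R.
Proof.
move=> e0 N0 zN; rewrite /ratio; case: xgetP => [_ -> [M [b [M0 zM ->]]]|/(_ (c%:~R / N%:R))[]]; last first.
  by exists N, c.
have : e *~ (b * N%:Z - c * M%:Z) = 0.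
  by rewrite mulrzBr !mulrzA -zN -zM !pmulrn mulrzAC subrr.
move=> /torsion_free_mulz[//|/eqP]; rewrite subr_eq0 => /eqP bN.
have NQ : (N%:R : rat) != 0 by rewrite pnatr_eq0 -lt0n.
have MQ : (M%:R : rat) != 0 by rewrite pnatr_eq0 -lt0n.
apply/eqP; rewrite eqr_div //; apply/eqP; have := congr1 (fun x : int => x%:~R : rat) bN.
by rewrite !intrM.
Qed.

Section Ratio.
Variables (S : set nat) (e : G).
Hypothesis e0 : e <> 0.

Lemma line_ratio z : line S e z -> localization S (ratio e z).
Proof.
move=> [N SN [c zN]]; have [N0 _] := SN.
by apply/localizationP; exists N => //; exists c; apply: ratioE.
Qed.

Lemma ratio_eq0 z : line S e z -> ratio e z = 0 -> z = 0.
Proof.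
move=> [N [N0 _] [c zN]]; rewrite (ratioE e0 N0 zN) => /eqP.
rewrite mulf_eq0 invr_eq0 intr_eq0 pnatr_eq0 eqn0Ngt N0 orbF => /eqP c0.
by apply: (torsion_free_mulIn N0); rewrite zN c0 mulr0z mul0rn.
Qed.

Lemma ratioB y z : line S e y -> line S e z -> ratio e (y - z) = ratio e y - ratio e z.
Proof.
move=> [N [N0 _] [c yN]] [M [M0 _] [b zM]].
rewrite (ratioE e0 N0 yN) (ratioE e0 M0 zM).
have NM : (0 < N * M)%N by rewrite muln_gt0 N0.
rewrite (@ratioE _ _ _ (c * M%:Z - b * N%:Z) e0 NM); last first.
  by rewrite mulrnBl mulrnA yN mulnC mulrnA zM mulrzBr !mulrzA !pmulrn.
have NQ : (N%:R : rat) != 0 by rewrite pnatr_eq0 -lt0n.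
have MQ : (M%:R : rat) != 0 by rewrite pnatr_eq0 -lt0n.
by rewrite intrD mulrNz !intrM natrM; field; apply/andP.
Qed.

Lemma ratioMn z k : line S e z -> ratio e (z *+ k) = ratio e z *+ k.
Proof.
move=> [N [N0 _] [c zN]]; rewrite (ratioE e0 N0 zN).
rewrite (@ratioE _ _ _ (c * k%:Z) e0 N0); last by rewrite mulrnAC zN mulrzA pmulrn.
by rewrite intrM -[RHS]mulr_natr mulrAC.
Qed.

End Ratio.

Definition prime_divisors A e : set nat := [set p | prime p /\ divides_in A p e].

(** The height of such an [e] at each prime is 0 or infinite. *)
Definition idempotent_generator A e : Prop :=
  [/\ A e, e <> 0 & forall p, prime_divisors A e p -> forall k, divides_in A (p ^ k) e].

Lemma divides_in1 A x : A x -> divides_in A 1 x.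
Proof. by exists x. Qed.

Lemma coprime_bezout a b x : coprime a b -> exists u v : int,
  x = x *~ u *+ a + x *~ v *+ b.
Proof.
rewrite -[coprime a b]/(coprimez a b) => /coprimezP[[u v] /= uv].
by exists u, v; rewrite !pmulrn -!mulrzA -mulrzDr uv.
Qed.

Lemma divides_in_coprime A a b x : subgroup A -> coprime a b -> A x ->
  divides_in A a (x *+ b) -> divides_in A a x.
Proof.
move=> sA cab Ax [y Ay xy]; have [u [v xE]] := coprime_bezout x cab.
exists (x *~ u + y *~ v); first by apply: subgroupD => //; apply: subgroupMz.
by rewrite {1}xE mulrnDl; congr (_ + _); rewrite pmulrn mulrzAC -pmulrn xy !pmulrn mulrzAC.
Qed.

Lemma divides_in_mul A a b x : subgroup A -> coprime a b ->
  divides_in A a x -> divides_in A b x -> divides_in A (a * b) x.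
Proof.
move=> sA cab [y Ay xy] [z Az xz]; have [u [v xE]] := coprime_bezout x cab.
exists (z *~ u + y *~ v); first by apply: subgroupD => //; apply: subgroupMz.
rewrite mulrnDl xE; congr (_ + _).
  by rewrite {1}xz mulnC mulrnA !pmulrn [z *~ _ *~ u]mulrzAC.
by rewrite {1}xy mulrnA !pmulrn [y *~ _ *~ v]mulrzAC.
Qed.

Lemma divides_in_dvdn A a b x : subgroup A -> (a %| b)%N ->
  divides_in A b x -> divides_in A a x.
Proof.
move=> sA /dvdnP[k ->] [y Ay ->]; exists (y *+ k); first exact: subgroupMn.
by rewrite -mulrnA.
Qed.

(** Finitely many primes of finite nonzero height can be divided out one by
one. *)
Lemma idempotent_generator_exists A x (s : seq nat) : subgroup A -> A x -> x <> 0 ->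
  (forall p, p \notin s -> prime_divisors A x p -> forall k, divides_in A (p ^ k) x) ->
  exists e, idempotent_generator A e.
Proof.
move=> sA; elim: s x => [|p s IHs] x Ax x0 good; first by exists x; split=> // p; apply: good.
have [goodp|/existsNP[pp /existsNP[k0 nk0]]] :=
    pselect (prime_divisors A x p -> forall k, divides_in A (p ^ k) x).
  apply: (IHs x) => // q qs; have [->//|qp] := eqVneq q p.
  by apply: good; rewrite inE negb_or qp.
have exk : exists k, `[< ~ divides_in A (p ^ k) x >] by exists k0; apply/asboolP.
case: (ex_minnP exk) => -[|k] /asboolP nk mink.
  by case: nk; rewrite expn0; apply: divides_in1.
have [y Ay xy] : divides_in A (p ^ k) x.
  by apply: contrapT => /asboolP /mink; rewrite ltnn.
apply: (IHs y) => //.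
  by move=> y0; apply: x0; rewrite xy y0 mul0rn.
move=> q qs [qq [z Az yz]] j.
have qp : q != p.
  apply/eqP => qp; apply: nk; exists z => //.
  by rewrite xy yz qp -mulrnA -expnS.
apply: (@divides_in_coprime _ _ (p ^ k)) => //.
  by rewrite coprimeXl // coprimeXr // prime_coprime // dvdn_prime2 //; case: pp.
rewrite -xy; apply: good; first by rewrite inE negb_or qp.
split=> //; exists (z *+ p ^ k); first exact: subgroupMn.
by rewrite xy yz mulrnAC.
Qed.

Lemma height_NoneP A x p : A x -> 
  height A x p = None <-> forall k, divides_in A (val p ^ k) x.
Proof.
move=> Ax; rewrite /height; case: pselect => [ex|nex]; split=> //.
  by have [k /asboolP nk] := ex => h; case: nk; apply: h.
move=> _ [|k]; first by rewrite expn0; apply: divides_in1.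
by apply: contrapT => nk; apply: nex; exists k; apply/asboolP.
Qed.

Lemma height_Some0P A x p :
  height A x p = Some 0%N <-> ~ divides_in A (val p) x.
Proof.
rewrite /height; case: pselect => [ex|nex]; last first.
  split=> // np; case: nex; exists 0%N; rewrite expn1; exact/asboolP.
case: ex_minnP => k /asboolP; rewrite -/(divides_in _ _ _) => nk mink.
split=> [[k0]|np]; first by rewrite k0 expn1 in nk.
by congr Some; apply/eqP; rewrite -leqn0; apply: mink; rewrite expn1; apply/asboolP.
Qed.

Lemma idempotent_type_generator A : rank_one A -> idempotent_type (type_of A) ->
  exists e, idempotent_generator A e.
Proof.
move=> [sA _] [chi [x [Ax x0 [fin ne]]] idem].
have [s sE] := (finite_seqP _).1 fin.
apply: (@idempotent_generator_exists _ x (map val s)) => // p ps [pp px] k.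
pose P : {p | prime p} := exist _ p pp.
have hP : height A x P = chi P.
  apply: contrapT => nP; case/mapP: ps; exists P => //.
  by have : [set p | height A x p <> chi p] P by []; rewrite sE.
case: (idem P); rewrite -hP; first by move/height_Some0P.
by move=> /(height_NoneP _ Ax)/(_ k).
Qed.

Section Generator.
Variables (A : set G) (e : G).
Hypotheses (rA : rank_one A) (gen : idempotent_generator A e).

Let S := prime_divisors A e.

(** Divisibility by each prime power dividing [N] adds up, these prime powers
being coprime. *)
Lemma generator_divides N : prime_supported S N -> divides_in A N e.
Proof.
have [Ae _ div] := gen; have [sA _] := rA.
elim/ltn_ind: N => N IHN [N0 SN].
have [N1|N1] := leqP N 1; first by rewrite (_ : N = 1%N); [exact: divides_in1 | lia].
have [p pp pN] : exists2 p, prime p & (p %| N)%N.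
  by exists (pdiv N); [apply: pdiv_prime | apply: pdiv_dvd].
have := pfactor_coprime pp N0; have : (0 < logn p N)%N by rewrite logn_gt0 mem_primes pp N0.
move: (logn p N) => k k0 [m cpm NE]; subst N.
have m0 : (0 < m)%N by case: m N0 {IHN cpm SN N1 pN}.
apply: divides_in_mul => //; first by rewrite coprime_sym coprimeXl.
  apply: IHN; first by rewrite ltn_Pmulr // -(expn0 p) ltn_exp2l // prime_gt1.
  by split=> // q qq qm; apply: SN => //; rewrite dvdn_mulr.
by apply: div; apply: SN.
Qed.

(** If [z] is the rational multiple [a / b] of [e] in lowest terms, then [b]
divides [a] times [e], hence [e] itself, so all primes dividing [b] divide
[e]. *)
Lemma generator_line : A = line S e.
Proof.
have [Ae e0 div] := gen; have [sA [_ dep]] := rA.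
apply/seteqP; split=> z; last first.
  move=> [N SN [c zN]]; have [w Aw ew] := generator_divides SN.
  suff -> : z = w *~ c by apply: subgroupMz.
  have N0 := SN.1; apply: (torsion_free_mulIn N0).
  by rewrite zN ew !pmulrn mulrzAC.
move=> Az; pose f (i : 'I_2) := if i == ord0 then z else e.
have /existsNP[c /not_implyP[rel /existsNP[i ci]]] : ~ independent f.
  by apply: dep => j; rewrite /f; case: ifP.
move: rel; rewrite !big_ord_recl big_ord0 addr0 /f /=.
rewrite (_ : lift ord0 ord0 = ord_max :> 'I_2); last exact: val_inj.
set a := c ord0; set b := c ord_max => rel.
have a0 : a != 0.
  apply/eqP => a0; move: rel; rewrite a0 mulr0z add0r => /torsion_free_mulz[//|b0].
  apply: ci; case: i => [[|[|]]] // lt.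
    by rewrite (_ : Ordinal lt = ord0); [|exact: val_inj].
  by rewrite (_ : Ordinal lt = ord_max); [|exact: val_inj].
(* The ratio of z to e, in lowest terms. *)
pose r : rat := - (b%:~R / a%:~R).
have ra : numq r * a = - (b * denq r).
  have aQ : (a%:~R : rat) != 0 by rewrite intr_eq0.
  have dQ : ((denq r)%:~R : rat) != 0 by rewrite intr_eq0 denq_neq0.
  have rE : (numq r)%:~R / (denq r)%:~R = - (b%:~R / a%:~R) :> rat by rewrite divq_num_den.
  apply/eqP; rewrite -(eqr_int rat) intrM mulrNz intrM -(divfK dQ (numq r)%:~R) rE.
  by apply/eqP; field.
have zr : z *~ denq r = e *~ numq r.
  apply/eqP; rewrite -subr_eq0; apply/eqP.
  have /torsion_free_mulz[//|/eqP] : (z *~ denq r - e *~ numq r) *~ a = 0.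
    rewrite mulrzBl -!mulrzA ra mulrNz opprK [denq r * a]mulrC 2!mulrzA.
    by rewrite -mulrzDl rel mul0rz.
  by rewrite (negPf a0).
have NE : `|denq r|%N = denq r :> int by rewrite absz_denq.
exists `|denq r|%N; last by exists (numq r); rewrite pmulrn NE.
split=> [|p pp pr]; first by rewrite absz_gt0 denq_neq0.
split=> //; apply: divides_in_dvdn pr _ => //.
apply: (@divides_in_coprime _ _ `|numq r|%N) => //; first by rewrite coprime_sym coprime_num_den.
exists (z *~ sgz (numq r)); first exact: subgroupMz.
by rewrite !pmulrn NE abszEsg mulrC mulrzA -zr mulrzAC.
Qed.
End Generator.

Lemma generator_height A e p : idempotent_generator A e ->
  height A e p = None <-> prime_divisors A e (val p).
Proof.
move=> [Ae _ div]; rewrite (height_NoneP _ Ae).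
split=> [h|Sp k]; last exact: div.
by split; [exact: (valP p) | have := h 1%N; rewrite expn1].
Qed.

Lemma generator_height_type A e : idempotent_generator A e -> type_of A (height A e).
Proof.
move=> [Ae e0 _]; exists e; split=> //; split=> //.
by rewrite (_ : [set _ | _] = set0); [exact: finite_set0 | apply/seteqP; split].
Qed.

Lemma generator_type_le A B e e' :
  idempotent_generator A e -> idempotent_generator B e' ->
  prime_divisors A e `<=` prime_divisors B e' -> gtype_le (type_of A) (type_of B).
Proof.
move=> gA gB AB; exists (height A e), (height B e').
split; [exact: generator_height_type|exact: generator_height_type|] => p.
have [Ap|nAp] := pselect (prime_divisors A e (val p)).
  by rewrite ((generator_height p gB).2 (AB _ Ap)); case: height.
have -> : height A e p = Some 0%N.
  by apply/height_Some0P => Ap; apply: nAp; split=> //; apply: valP.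
by case: height.
Qed.

(** Infinite entries are common to equivalent characteristics, so some nonzero
[x] of [B] is divisible by all powers of a prime that divides [e]; the ratio of
[x] to [e'] is a nonzero fraction with this property. *)
Lemma generator_type_eq A B e e' : rank_one B ->
  idempotent_generator A e -> idempotent_generator B e' ->
  type_of A = type_of B -> prime_divisors A e `<=` prime_divisors B e'.
Proof.
move=> rB gA gB AB p Ap; have := generator_height_type gA.
have [_ e'0 _] := gB.
rewrite AB => -[x [Bx x0 [_ eqh]]].
pose P : {p | prime p} := exist _ p Ap.1.
have hA : height A e P = None by apply/generator_height.
have hB : height B x P = None.
  by rewrite -hA; apply: contrapT => /eqh[_]; rewrite hA.
have lB := generator_line rB gB; set S := prime_divisors B e' in lB *.
have lx : line S e' x by rewrite -lB.
apply: (@localization_divisible S p (ratio e' x)); first exact: Ap.1.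
  move=> k; have [y By xE] := (height_NoneP P Bx).1 hB k.
  have ly : line S e' y by rewrite -lB.
  by exists (ratio e' y); [exact: line_ratio | rewrite xE; apply: ratioMn ly].
by apply/eqP => r0; apply: x0; apply: (ratio_eq0 _ lx).
Qed.

End RankOne.

(** * Coordinates *)

(** An embedding of [G] in rational vectors under which [R] corresponds to the
product of the localizations of the integers at the sets [S i]. *)
Record coordinates (G : zmodType) (R : set G) n (S : 'I_n -> set nat)
    (phi : 'I_n -> G -> rat) : Prop := Coordinates {
  coord_prime : forall i p, S i p -> prime p;
  coord_additive : forall i, zmod_morphism (phi i);
  coord_inj : forall x, (forall i, phi i x = 0) -> x = 0;
  coord_surj : forall v, (forall i, localization (S i) (v i)) ->
    exists x, forall i, phi i x = v i;
  coord_mem : forall x, R x <-> forall i, localization (S i) (phi i x)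
}.

(** The i-th coordinate of [x] is the ratio to [e i] of the i-th component of
[x *+ M], divided by [M]. *)
Lemma coordinates_exist (G : zmodType) (R : set G) n (A : 'I_n -> set G) (e : 'I_n -> G) M :
  torsion_free G -> cd_decomposition R A ->
  (forall i, idempotent_generator (A i) (e i)) ->
  (0 < M)%N -> (forall x, R (x *+ M)) ->
  exists phi, coordinates R (fun i => prime_divisors (A i) (e i)) phi.
Proof.
move=> tfG [[sA RE indA] rA] gen M0 RM.
have e0 i : e i <> 0 by case: (gen i).
have lA i := generator_line tfG (rA i) (gen i).
pose S i := prime_divisors (A i) (e i).
have MQ : (M%:R : rat) != 0 by rewrite pnatr_eq0 -lt0n.
have /choice[a aP] x : exists a : 'I_n -> G, (forall i, A i (a i)) /\ x *+ M = \sum_i a i.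
  by have := RM x; rewrite RE => -[a]; exists a.
have aE x (b : 'I_n -> G) : (forall i, A i (b i)) -> x *+ M = \sum_i b i -> a x = b.
  move=> Ab xb; apply/funext => i; apply/eqP; rewrite -subr_eq0; apply/eqP.
  have [Aa xa] := aP x; apply: (indA (fun i => a x i - b i)).
    by move=> j; apply: subgroupB.
  by rewrite sumrB -xa -xb subrr.
have la x i : line (S i) (e i) (a x i) by rewrite -lA; apply: (aP x).1.
have w i q : exists w, localization (S i) q -> A i w /\ ratio (e i) w = q.
  have [/localizationP[N SN [c qE]]|nq] := pselect (localization (S i) q); last by exists 0.
  have [y Ay yN] := generator_divides (rA i) (gen i) SN.
  exists (y *~ c) => _; split; first exact: subgroupMz.
  rewrite qE; apply: ratioE => //; first by case: SN.
  by rewrite yN !pmulrn mulrzAC.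
have sumR v : (forall i, localization (S i) (v i)) ->
    exists x, R x /\ forall i, ratio (e i) (a x i) / M%:R = v i.
  move=> Sv; have /choice[b bP] i : exists b, A i b /\ ratio (e i) b = v i.
    by have [b bP] := w i (v i); exists b; apply: bP.
  exists (\sum_i b i); split; first by rewrite RE; exists b => // i; case: (bP i).
  move=> i; rewrite (aE _ (fun i => b i *+ M)).
  - have [Ab <-] := bP i; rewrite (ratioMn tfG (S := S i)) //; last by rewrite -lA.
    by rewrite -[X in X / _]mulr_natr mulfK.
  - by move=> j; apply: subgroupMn => //; case: (bP j).
  - by rewrite sumrMnl.
have inj x : (forall i, ratio (e i) (a x i) / M%:R = 0) -> x = 0.
  move=> x0; apply: (torsion_free_mulIn tfG M0).
  rewrite (aP x).2 mul0rn big1 // => i _; apply: (ratio_eq0 tfG (e0 i) (la x i)).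
  by apply/eqP; have /eqP := x0 i; rewrite mulf_eq0 invr_eq0 (negPf MQ) orbF.
have add i : zmod_morphism (fun x => ratio (e i) (a x i) / M%:R).
  move=> x y; rewrite (aE _ (fun i => a x i - a y i)).
  - by rewrite (ratioB tfG (e0 i) (la x i) (la y i)) mulrBl.
  - by move=> j; apply: subgroupB => //; apply: (aP _).1.
  - by rewrite mulrnBl (aP x).2 (aP y).2 sumrB.
exists (fun i x => ratio (e i) (a x i) / M%:R); split=> //.
- by move=> i p [].
- by move=> v /sumR[x [_ xv]]; exists x.
- move=> x; split.
    rewrite RE => -[b Ab xE] i; rewrite (aE _ (fun i => b i *+ M)).
    + rewrite (ratioMn tfG (S := S i)) //; last by rewrite -lA.
      rewrite -[X in X / _]mulr_natr mulfK //; apply: line_ratio => //.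
      by rewrite -lA.
    + by move=> j; apply: subgroupMn.
    + by rewrite xE sumrMnl.
  move=> /sumR[y [Ry yx]]; suff -> : x = y by [].
  apply/eqP; rewrite -subr_eq0; apply/eqP/inj => i.
  by rewrite [LHS]add yx subrr.
Qed.

(** * Maximality and purity of the regulator *)

Section Coordinates.
Variables (G : zmodType) (R : set G) (n : nat) (S : 'I_n -> set nat).
Variable phi : 'I_n -> G -> rat.
Hypothesis cR : coordinates R S phi.

Let coord i : {additive G -> rat} :=
  HB.pack (phi i) (GRing.isZmodMorphism.Build _ _ (phi i) (coord_additive cR i)).

Lemma coordB i x y : phi i (x - y) = phi i x - phi i y.
Proof. exact: coord_additive cR i x y. Qed.

Lemma coord0 i : phi i 0 = 0.
Proof. exact: raddf0 (coord i). Qed.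

Lemma coordD i x y : phi i (x + y) = phi i x + phi i y.
Proof. exact: (raddfD (coord i)). Qed.

Lemma coordMn i x k : phi i (x *+ k) = phi i x *+ k.
Proof. exact: (raddfMn (coord i)). Qed.

Lemma coordMz i x k : phi i (x *~ k) = phi i x *~ k.
Proof. exact: (raddfMz (coord i)). Qed.

Lemma coord_sum i (F : 'I_n -> G) : phi i (\sum_j F j) = \sum_j phi i (F j).
Proof. exact: (raddf_sum (coord i)). Qed.

Lemma coord_eq x y : (forall i, phi i x = phi i y) -> x = y.
Proof.
move=> xy; apply/eqP; rewrite -subr_eq0; apply/eqP/(coord_inj cR) => i.
by rewrite coordB xy subrr.
Qed.

Lemma coord_torsion_free : torsion_free G.
Proof.
move=> x k xk; case: (posnP k) => [->|k0]; [by right|left].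
apply: (coord_inj cR) => i; apply/eqP; have /eqP := congr1 (phi i) xk.
by rewrite coord0 coordMn -mulr_natr mulf_eq0 pnatr_eq0 eqn0Ngt k0 orbF.
Qed.

Lemma coord_inclusion : exists inc : 'I_n -> rat -> G, forall i q,
  localization (S i) q -> forall j, phi j (inc i q) = if j == i then q else 0.
Proof.
suff /choice[inc incP] i : exists inc : rat -> G, forall q,
    localization (S i) q -> forall j, phi j (inc q) = if j == i then q else 0.
  by exists inc.
suff /choice[inc incP] q : exists x : G, localization (S i) q ->
    forall j, phi j x = if j == i then q else 0.
  by exists inc.
have [Sq|nS] := pselect (localization (S i) q); last by exists 0.
have [|x xP] := coord_surj cR (v := fun j => if j == i then q else 0).
  by move=> j; case: eqP => [->//|_]; apply: (localization_int _ 0).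
by exists x.
Qed.

Lemma coord_line i e z : line (S i) e z ->
  exists2 q, localization (S i) q & forall k, phi k z = q * phi k e.
Proof.
move=> [N SN [c zN]]; exists (c%:~R / N%:R).
  by apply/localizationP; exists N => //; exists c.
move=> k; have := congr1 (phi k) zN; rewrite coordMn coordMz => zNk.
have NQ : (N%:R : rat) != 0 by case: SN; rewrite pnatr_eq0 lt0n.
by apply: (mulIf NQ); rewrite mulr_natr zNk mulrAC divfK // mulrzl.
Qed.

Lemma line_coord i e z q : localization (S i) q ->
  (forall k, phi k z = q * phi k e) -> line (S i) e z.
Proof.
move=> /localizationP[N SN [c qE]] zE; exists N => //; exists c.
apply: coord_eq => k; rewrite coordMn coordMz zE qE.
have NQ : (N%:R : rat) != 0 by case: SN; rewrite pnatr_eq0 lt0n.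
by rewrite -[LHS]mulr_natr mulrAC divfK // mulrzl.
Qed.

Lemma coord_expansion (inc : 'I_n -> rat -> G) x :
  (forall i q, localization (S i) q ->
     forall j, phi j (inc i q) = if j == i then q else 0) ->
  R x -> x = \sum_i inc i (phi i x).
Proof.
move=> incP /(coord_mem cR) Sx; apply: coord_eq => k.
rewrite coord_sum (bigD1 k) //= incP // eqxx big1 ?addr0 // => i ni.
by rewrite incP // eq_sym (negPf ni).
Qed.

Variable M : nat.
Hypotheses (M0 : (0 < M)%N) (RM : forall x, R (x *+ M)).
Hypothesis sR : subgroup R.

Section Purity.
Hypothesis maxR : forall C : set G, completely_decomposable C -> R `<=` C -> C `<=` R.

(** The basis vector at [j0] is [p] times [b] up to a combination of the other
basis vectors, so [b] can replace it.  The resulting completely decomposable group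
contains [R], hence lies in [R], and [1 / p] is a coordinate of an element of
[R]. *)
Lemma coord_adjoin j0 b p : prime p -> R (b *+ p) -> phi j0 b = p%:R^-1 ->
  (forall j, phi j b != 0 -> S j = S j0) -> S j0 p.
Proof.
move=> pp Rpb bj0 suppb.
have pQ : (p%:R : rat) != 0 by rewrite pnatr_eq0 -lt0n prime_gt0.
have [inc incP] := coord_inclusion.
have loc1 i : localization (S i) 1 := localization_int _ 1.
pose e j := if j == j0 then b else inc j 1.
have ej k j : j != j0 -> phi k (e j) = (k == j)%:R.
  by rewrite /e => /negPf ->; rewrite incP //; case: eqP.
have e0 j : e j <> 0.
  move=> /(congr1 (phi j)); rewrite coord0.
  have [->|nj] := eqVneq j j0; last by rewrite ej // eqxx => /eqP; rewrite oner_eq0.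
  by rewrite /e eqxx bj0 => /eqP; rewrite invr_eq0 (negPf pQ).
pose A j := line (S j) (e j).
pose C := [set x | exists2 a : 'I_n -> G, (forall i, A i (a i)) & x = \sum_i a i].
have cdC : completely_decomposable C.
  exists n, A; split; last first.
    by move=> j; apply: line_rank_one => //; apply: coord_torsion_free.
  split=> // [j|a Aa a0]; first exact: line_subgroup.
  have /choice[q qP] j : exists q, forall k, phi k (a j) = q * phi k (e j).
    by have [q _ qE] := coord_line (Aa j); exists q.
  (* The j0-th coordinate of the sum sees only the component along b. *)
  have q0 : q j0 = 0.
    have := congr1 (phi j0) a0; rewrite coord_sum coord0.
    rewrite (bigD1 j0) //= big1 ?addr0 => [|j nj].
      by rewrite qP /e eqxx bj0 => /eqP; rewrite mulf_eq0 invr_eq0 (negPf pQ) orbF => /eqP.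
    by rewrite qP ej // eq_sym (negPf nj) mulr0.
  have aj0 : a j0 = 0 by apply: (coord_inj cR) => k; rewrite qP q0 mul0r.
  move=> i; have [->//|ni] := eqVneq i j0.
  suff qi : q i = 0 by apply: (coord_inj cR) => k; rewrite qP qi mul0r.
  have := congr1 (phi i) a0; rewrite coord_sum coord0.
  rewrite (bigD1 i) //= big1 ?addr0 => [|j nj].
    by rewrite qP ej // eqxx mulr1.
  have [->|nj0] := eqVneq j j0; first by rewrite qP q0 mul0r.
  by rewrite qP ej // eq_sym (negPf nj) mulr0.
have Cb : C b.
  exists (fun j => if j == j0 then b else 0).
    move=> j; rewrite /A /e; case: eqP => _; last exact: subgroup0 (line_subgroup _ _).
    exact: (line_coord (q := 1) (loc1 j) (fun k => esym (mul1r _))).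
  by rewrite -big_mkcond big_pred1_eq.
have RC : R `<=` C.
  (* Subtract the multiple z of b with the same j0-th coordinate as x; it lies
     in R because the nonzero coordinates of b have indices in the class of j0. *)
  move=> x Rx; have Sx := (coord_mem cR x).1 Rx.
  have Sb := (coord_mem cR _).1 Rpb.
  have Sz k : localization (S k) (phi j0 x * phi k (b *+ p)).
    have [bk|/suppb kj0] := eqVneq (phi k b) 0.
      by rewrite coordMn bk mul0rn mulr0; apply: (localization_int _ 0).
    by apply: localizationM; rewrite // kj0.
  have [z zP] := coord_surj cR Sz.
  pose a k := if k == j0 then z else inc k (phi k (x - z)).
  have Sxz k : localization (S k) (phi k (x - z)).
    by rewrite coordB; apply: localizationB => //; rewrite zP.
  have zj0 : phi j0 z = phi j0 x.
    by rewrite zP coordMn bj0 -[_ *+ p]mulr_natr mulVf // mulr1.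
  exists a.
    move=> k; rewrite /A /a /e; have [->|nk] := eqVneq k j0.
      rewrite ?eqxx; apply: (line_coord (q := phi j0 x * p%:R)).
        by apply: localizationM => //; apply: (localization_int _ p).
      by move=> i; rewrite zP coordMn -[_ *+ p]mulr_natr [phi i b * _]mulrC mulrA.
    apply: (line_coord (Sxz k)) => i; rewrite !incP //; case: eqP => _; first by rewrite mulr1.
    by rewrite mulr0.
  apply: coord_eq => k; rewrite coord_sum (bigD1 j0) //= {1}/a eqxx.
  have [->|nk] := eqVneq k j0.
    rewrite zj0 big1 ?addr0 // => i ni.
    by rewrite /a (negPf ni) incP // eq_sym (negPf ni).
  rewrite (bigD1 k) //= big1 => [|i /andP[ni nik]]; last first.
    by rewrite /a (negPf ni) incP // eq_sym (negPf nik).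
  by rewrite /a (negPf nk) incP // eqxx addr0 coordB addrC subrK.
have /(coord_mem cR)/(_ j0) := maxR cdC RC Cb.
rewrite bj0 => /localizationP[N [N0 SN] [c cE]].
have NQ : (N%:R : rat) != 0 by rewrite pnatr_eq0 -lt0n.
have /eqP : (N%:Z)%:~R = (c * p%:Z)%:~R :> rat.
  by rewrite intrM -[c%:~R](divfK NQ) -cE; field.
rewrite eqr_int => /eqP Ncp; apply: SN => //.
have : (p%:Z %| N%:Z)%Z by rewrite Ncp dvdz_mull.
by rewrite dvdzE.
Qed.

(** It suffices to divide out one prime [p] at a time.  If [p] is not in [S j0]
and the coordinate at [j0] of [x] is not in the localization, some combination
of [x] with the basis vector at [j0] has coordinate [1 / p] there, and
[coord_adjoin] applies. *)
Lemma coord_pure y t : (forall j, phi j y != 0 -> S j = S t) -> R y.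
Proof.
have noloc : forall x p, prime p -> R (x *+ p) ->
    (forall j, phi j x != 0 -> S j = S t) -> R x.
  move=> x p pp Rpx suppx; apply/(coord_mem cR) => j0; apply: contrapT => nSx.
  have x0 : phi j0 x != 0.
    by apply: contra_notN nSx => /eqP ->; apply: (localization_int _ 0).
  have pQ : (p%:R : rat) != 0 by rewrite pnatr_eq0 -lt0n prime_gt0.
  have Spx := (coord_mem cR _).1 Rpx j0; rewrite coordMn in Spx.
  have nSp : ~ S j0 p.
    move=> Sp; apply: nSx; rewrite -[phi j0 x](mulfK pQ) mulr_natr.
    by apply: localization_div => //; apply: prime_supported_prime.
  have [u [v uv]] := localization_prime_denominator pp nSp Spx nSx.
  have [inc incP] := coord_inclusion.
  have loc1 i : localization (S i) 1 := localization_int _ 1.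
  apply: nSp; apply: (@coord_adjoin j0 (x *~ u + inc j0 1 *~ v)) => //.
  - rewrite mulrnDl; apply: subgroupD => //.
      by rewrite pmulrn mulrzAC -pmulrn; apply: subgroupMz.
    apply: subgroupMn => //; apply: subgroupMz => //; apply/(coord_mem cR) => k.
    by rewrite incP //; case: eqP => _; [|apply: (localization_int _ 0)].
  - by rewrite coordD !coordMz incP // eqxx -uv mulrzr.
  - move=> j; rewrite coordD !coordMz incP // (suppx _ x0).
    have [->|_] := eqVneq j j0; first by move=> _; apply: suppx.
    rewrite mul0rz addr0 -mulrzr mulf_eq0 negb_or => /andP[/suppx //].
suff H N : (0 < N)%N -> forall x, R (x *+ N) -> (forall j, phi j x != 0 -> S j = S t) -> R x.
  exact: H M0 y (RM y).
elim/ltn_ind: N => N IHN N0 x Rx suppx.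
have [N1|N1] := leqP N 1; first by rewrite -[x]mulr1n (_ : 1%N = N)//; lia.
have pp := pdiv_prime N1; have [k NE] := dvdnP (pdiv_dvd N); set p := pdiv N in pp NE.
have k0 : (0 < k)%N by move: N0; rewrite NE; case: (k).
apply: (IHN k) => //; first by rewrite NE ltn_Pmulr // prime_gt1.
apply: (noloc _ p) => //; first by rewrite -mulrnA -NE.
by move=> j; rewrite coordMn -mulr_natr mulf_eq0 negb_or => /andP[/suppx].
Qed.

End Purity.

(** * Endomorphisms and absolute ideals *)

Section Endomorphisms.
Hypothesis maxR : forall C : set G, completely_decomposable C -> R `<=` C -> C `<=` R.
Hypothesis rigid : forall i j, S i `<=` S j -> S i = S j.

(** The image of the i-th component of [x] is divisible by all powers of each
prime in [S i], so by rigidity its nonzero coordinates [j] have [S j = S i]. *)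
Lemma endomorphism_stable (f : {additive G -> G}) x : R x -> R (f x).
Proof.
have [inc incP] := coord_inclusion.
move=> Rx; have Sx := (coord_mem cR x).1 Rx.
rewrite (coord_expansion incP Rx) raddf_sum; apply: subgroup_sum => // i _.
apply: (coord_pure maxR (t := i)) => j fj0; apply/esym/rigid => p Sp.
have pp := coord_prime cR Sp.
apply: (@localization_divisible _ p (phi j (f (inc i (phi i x)) *+ M))) => //; last first.
  by rewrite coordMn -mulr_natr mulf_neq0 // pnatr_eq0 -lt0n.
move=> k; pose y := inc i (phi i x / (p ^ k)%:R).
have Spk : prime_supported (S i) (p ^ k).
  elim: k {y} => [|k IHk]; first exact: prime_supported1.
  by rewrite expnS; apply: prime_supportedM => //; apply: prime_supported_prime.
exists (phi j (f y *+ M)); first exact: (coord_mem cR _).1.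
transitivity (phi j (f (y *+ p ^ k) *+ M)); last by rewrite raddfMn !coordMn mulrnAC.
congr (phi j (f _ *+ M)).
apply: coord_eq => l; rewrite coordMn !incP //; last exact: localization_div.
case: eqP => _; last by rewrite mul0rn.
by rewrite -[RHS]mulr_natr divfK // pnatr_eq0 -lt0n; case: Spk.
Qed.

Variable g : G.
Hypothesis genR : forall x, exists k : int, R (x - g *~ k).

(** For each [i] there is a multiplication under which the i-th component of
[h x] is the product of [x] with a fixed element. *)
Lemma absolute_ideal_hom (I : set G) (h : G -> G) x : zmod_morphism h ->
  (forall y, R (h y)) -> absolute_ideal I -> I x -> I (h x).
Proof.
move=> addh Rh aI Ix; have [inc incP] := coord_inclusion.
have Sh i y := (coord_mem cR _).1 (Rh y) i.
have addinc i q r : localization (S i) q -> localization (S i) r ->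
    inc i (q - r) = inc i q - inc i r.
  move=> Sq Sr; apply: coord_eq => k; rewrite coordB !incP //; last exact: localizationB.
  by case: eqP => _; rewrite ?subr0.
rewrite (coord_expansion incP (Rh x)).
apply: subgroup_sum => [|i _]; first exact: absolute_ideal_subgroup.
have [d [Sdg [u [v duv]]]] := localization_span1 (S i) (phi i g).
pose lambda y := d%:R * phi i y.
have Slambda y : localization (S i) (lambda y).
  have [k Rk] := genR y; have -> : lambda y = d%:R * phi i (y - g *~ k) + d%:R * phi i g * k%:~R.
    by rewrite /lambda coordB coordMz -mulrzr; ring.
  apply: localizationD; apply: localizationM => //; last exact: localization_int.
    exact: (localization_int _ d).
  exact: (coord_mem cR _).1.
pose mu y z := inc i (lambda z * phi i (h y)).
have mulmu : multiplication mu.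
  split=> [y|z] a b; rewrite /mu -addinc; try exact: localizationM.
    by rewrite /lambda coordB mulrBr mulrBl.
  by rewrite addh coordB mulrBr.
(* The functional lambda takes the value 1 at this element. *)
pose one := inc i u%:~R + g *~ v.
have <- : mu x one = inc i (phi i (h x)).
  rewrite /mu /lambda coordD coordMz incP ?eqxx; last exact: localization_int.
  by rewrite -[_ *~ v]mulrzl duv mul1r.
by case: (aI mu mulmu) => _ /(_ one x Ix)[].
Qed.

(** An endomorphism differs from a multiplication by an integer by a
homomorphism into [R]. *)
Lemma coord_afi_group : afi_group G.
Proof.
move=> I aI; have sI := absolute_ideal_subgroup aI; split=> // f _ [x Ix <-].
have [k Rk] := genR (f g).
rewrite -(subrK (x *~ k) (f x)); apply: subgroupD; [by []| |exact: subgroupMz].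
apply: (@absolute_ideal_hom I (fun y => f y - y *~ k)) => //.
  by move=> y z; rewrite raddfB mulrzBl !opprB addrACA [in RHS]addrACA; congr (_ + _); rewrite addrC.
move=> y; have [l] := genR y; have := esym (subrK (g *~ l) y); move: (y - g *~ l) => r yE Rr.
have -> : f y - y *~ k = f r - r *~ k + (f g - g *~ k) *~ l.
  by rewrite yE raddfD raddfMz mulrzDl mulrzBl opprD addrACA [g *~ k *~ l]mulrzAC.
apply: subgroupD => //; last exact: subgroupMz.
by apply: subgroupB => //; [exact: endomorphism_stable | exact: subgroupMz].
Qed.

End Endomorphisms.

End Coordinates.

(** * The regulator *)

Lemma direct_sum_subgroup (G : zmodType) (H : set G) n (A : 'I_n -> set G) :
  direct_sum H A -> subgroup H.
Proof.
move=> [sA -> _]; apply/subgroupP; split.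
  by exists (fun=> 0); [move=> i; apply: subgroup0 | rewrite big1].
move=> _ _ [a Aa ->] [b Ab ->]; exists (fun i => a i - b i); last by rewrite sumrB.
by move=> i; apply: subgroupB.
Qed.

Lemma completely_decomposable_subgroup (G : zmodType) (H : set G) :
  completely_decomposable H -> subgroup H.
Proof. by move=> [n [A [dA _]]]; apply: direct_sum_subgroup dA. Qed.

Lemma regulating_exists (G : zmodType) : acd_group G -> exists C : set G, regulating C.
Proof.
move=> [_ _ [C [m [cdC im]]]].
have exm : exists m, `[< exists2 C : set G, completely_decomposable C & has_index C m >].
  by exists m; apply/asboolP; exists C.
case: (ex_minnP exm) => k /asboolP[D cdD ik] mink; exists D; split=> //.
by exists k => // D' k' cdD' ik'; apply: mink; apply/asboolP; exists D'.
Qed.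

(** All regulating subgroups contain the regulator and have the same index, so
they coincide. *)
Lemma crq_Reg_regulating (G : zmodType) : crq_group G -> regulating (Reg G).
Proof.
move=> [acdG cycG]; have [C regC] := regulating_exists acdG.
suff -> : Reg G = C by [].
apply/seteqP; split=> [x|x Cx]; first exact.
move=> D regD; have [cdC [m im minm]] := regC; have [cdD [m' im' minm']] := regD.
have mm' : m' = m.
  by apply/eqP; rewrite eqn_leq (minm' _ _ cdC im) (minm _ _ cdD im').
rewrite mm' in im'.
suff <- : C = D by [].
apply: cyclic_index_eq cycG _ _ _ _ im im'.
- exact: completely_decomposable_subgroup.
- exact: completely_decomposable_subgroup.
- by move=> y; apply.
- by move=> y; apply.
Qed.

(** A larger completely decomposable subgroup has a smaller index, but the index
of the regulator is the least possible one. *)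
Lemma crq_Reg_max (G : zmodType) (C : set G) : crq_group G ->
  completely_decomposable C -> Reg G `<=` C -> C `<=` Reg G.
Proof.
move=> crqG cdC RC; have [cdR [m im minm]] := crq_Reg_regulating crqG.
have [_ cycG] := crqG.
have sR := completely_decomposable_subgroup cdR.
have sC := completely_decomposable_subgroup cdC.
have [m' im' m'm] := cyclic_index_le cycG sR sC (fun _ => id) RC im.
have mm' : m' = m by apply/eqP; rewrite eqn_leq m'm (minm _ _ cdC im').
rewrite mm' in im'.
by rewrite (cyclic_index_eq cycG sR sC (fun _ => id) RC im im').
Qed.

Lemma critical_type_of (G : zmodType) n (A : 'I_n -> set G) i e :
  cd_decomposition (Reg G) A -> A i e -> e <> 0 -> critical_types G (type_of (A i)).
Proof.
move=> cdA Ae e0; have [[sA _ _] _] := cdA.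
exists n, A; split=> // comp0; apply: e0; suff : [set 0] e by []; rewrite -comp0.
exists (fun j => if j == i then e else 0).
  by move=> j; case: eqP => [->|_] //; apply: subgroup0.
by rewrite (bigD1 i) ?asboolT //= eqxx big1 ?addr0 // => j /andP[_ /negPf ->].
Qed.

Theorem theorem3p2 (G : zmodType) (hcrq : crq_group G)
  (hrigid : block_rigid G) (hring : ring_type G) : afi_group G.
Proof.
have [[tfG _ _] [g genR]] := hcrq.
have [cdR [m im _]] := crq_Reg_regulating hcrq.
have sR := completely_decomposable_subgroup cdR.
have [M M0 Rg] := index_multiple g sR im.
have RM x : Reg G (x *+ M).
  have [k Rk] := genR x; rewrite -(subrK (g *~ k) x) mulrnDl.
  apply: (subgroupD sR); first exact: subgroupMn sR Rk.
  by rewrite pmulrn mulrzAC -pmulrn; apply: subgroupMz sR Rg.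
have [n [A cdA]] := cdR; have [_ rA] := cdA.
have crit i : critical_types G (type_of (A i)).
  have [_ [[x Ax indx] _]] := rA i.
  apply: (critical_type_of cdA (Ax ord0)) => x0.
  by have := indx (fun=> 1); rewrite big_ord1 x0 mul0rz => /(_ erefl ord0).
have /choice[e gen] i : exists e, idempotent_generator (A i) e.
  exact/idempotent_type_generator/hring.
have [phi cR] := coordinates_exist tfG cdA gen M0 RM.
apply: (coord_afi_group cR M0 RM sR _ _ genR).
  by move=> C; apply: crq_Reg_max.
move=> i j Sij; have le := generator_type_le (gen i) (gen j) Sij.
have tE : type_of (A i) = type_of (A j).
  by apply: contrapT => /(hrigid _ _ (crit i) (crit j))[].
by apply/seteqP; split=> //; apply: generator_type_eq (gen j) (gen i) (esym tE).
Qed.
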